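(* Let $X$ be a real Banach space. Suppose that for every $\varepsilon>0$ there is a $\delta>0$ such that for every $f\in\mathrm{Lip}_0(X)$ with $\|f\|=1$ and for every pair $(x,y)\in X\times X$, $x\neq y$, with $\frac{f(x)-f(y)}{\|x-y\|}>1-\delta$ there are $g\in\mathrm{Lip}_0(X)$ with $\|g\|=1$ and a sequence of pairs $\{(v_n,w_n)\}$ in $X\times X$ with $v_n\neq w_n$ for every $n$, such that $\lim_{n\to\infty}\frac{g(v_n)-g(w_n)}{\|v_n-w_n\|}=1$, $\|g-f\|<\varepsilon$, and, for every $n$, $\left\|\frac{x-y}{\|x-y\|}-\frac{v_n-w_n}{\|v_n-w_n\|}\right\|<\varepsilon$, $\|v_n-w_n\|<\varepsilon$, and $\mathrm{dist}(v_n,\mathrm{conv}\{x,y\})<\varepsilon$. Then $X$ has the local directional Bishop-Phelps-Bollob\'as property for Lipschitz functionals.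
   Context: $S_X$ is the unit sphere of $X$. $\mathrm{Lip}_0(X)$ is the Banach space of all Lipschitz functions $f:X\to\mathbb{R}$ with $f(0)=0$, with norm $\|f\|=\sup\left\{\frac{|f(x)-f(y)|}{\|x-y\|}: x,y\in X,\ x\neq y\right\}$. A functional $g\in\mathrm{Lip}_0(X)$ attains its norm in a point $v\in X$ at the direction $u\in S_X$ if there is a sequence of pairs $\{(x_n,y_n)\}$ in $X\times X$, with $x_n\neq y_n$, such that $\lim_n x_n=\lim_n y_n=v$, $\lim_n\frac{x_n-y_n}{\|x_n-y_n\|}=u$, and $\lim_n\frac{g(x_n)-g(y_n)}{\|x_n-y_n\|}=\|g\|$. A Banach space $X$ has the local directional Bishop-Phelps-Bollob\'as property for Lipschitz functionals if for every $\varepsilon>0$ there is a $\delta>0$ such that for every $f\in\mathrm{Lip}_0(X)$ with $\|f\|=1$ and for every $x,y\in X$ with $x\neq y$ satisfying $\frac{f(x)-f(y)}{\|x-y\|}>1-\delta$, there are $g\in\mathrm{Lip}_0(X)$ with $\|g\|=1$, $v\in X$ and $u\in S_X$ such that $g$ attains its norm in the point $v$ at the direction $u$, $\|g-f\|<\varepsilon$, $\left\|\frac{x-y}{\|x-y\|}-u\right\|<\varepsilon$, and $\mathrm{dist}(v,\mathrm{conv}\{x,y\})<\varepsilon$. Here $\mathrm{conv}\{x,y\}$ is the closed segment joining $x$ and $y$, and $\mathrm{dist}$ is the norm distance. *)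

(* Defs.v *)
From HB Require Import structures.
From mathcomp Require Import all_boot all_order all_algebra.
From mathcomp Require Import all_classical all_reals all_analysis.

Set Implicit Arguments.
Unset Strict Implicit.
Unset Printing Implicit Defensive.

Import Order.TTheory GRing.Theory Num.Theory.
Import numFieldNormedType.Exports.

Local Open Scope classical_set_scope.
Local Open Scope ring_scope.

Definition slope (R : realType) (X : normedModType R) (f : X -> R) (x y : X) : R :=
  (f x - f y) / `|x - y|.

Definition direction (R : realType) (X : normedModType R) (x y : X) : X :=
  `|x - y|^-1 *: (x - y).

Definition Lip0 (R : realType) (X : normedModType R) : set (X -> R) :=
  [set f | [lipschitz f x | x in [set: X]] /\ f 0 = 0].

(* For Lipschitz f the set below is bounded above, so [sup] is the genuine
   supremum; when X = {0} the set is empty and [sup] is 0, the norm of the only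
   element of Lip0 X. *)
Definition lip_norm (R : realType) (X : normedModType R) (f : X -> R) : R :=
  sup [set `|f p.1 - f p.2| / `|p.1 - p.2| | p in [set p : X * X | p.1 != p.2]].

Definition conv2 (R : realType) (X : normedModType R) (x y : X) : set X :=
  [set (1 - t) *: x + t *: y | t in `[0, 1]%classic].

(* Used only with nonempty A, where [inf] is the genuine infimum. *)
Definition dist (R : realType) (X : normedModType R) (v : X) (A : set X) : R :=
  inf [set `|v - z| | z in A].

Definition attains_norm_at (R : realType) (X : normedModType R)
    (g : X -> R) (v u : X) : Prop :=
  exists x y : nat -> X,
    [/\ forall n, x n != y n,
        x n @[n --> \oo] --> v,
        y n @[n --> \oo] --> v,
        direction (x n) (y n) @[n --> \oo] --> u &
        slope g (x n) (y n) @[n --> \oo] --> lip_norm g].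

Definition local_directional_BPBp (R : realType) (X : normedModType R) : Prop :=
  forall eps : R, 0 < eps -> exists2 delta : R, 0 < delta &
    forall f : X -> R, Lip0 f -> lip_norm f = 1 ->
    forall x y : X, x != y -> 1 - delta < slope f x y ->
    exists (g : X -> R) (v u : X),
      [/\ Lip0 g, lip_norm g = 1 & `|u| = 1] /\
      [/\ attains_norm_at g v u,
          lip_norm (g \- f) < eps,
          `|direction x y - u| < eps &
          dist v (conv2 x y) < eps].

(* Main.v *)
(* Iterate the hypothesis with tolerances c / 2^n: a near-norming pair (v_m, w_m)
   of the perturbed function is so good that it can serve as the input pair of
   the next step.  The successive pairs are then close, have mutual distance
   tending to 0 and slowly varying direction, so the pairs, their directions and
   the functions all converge, and the limit function attains its norm along the
   pairs. *)

Require Import Defs.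
From HB Require Import structures.
From mathcomp Require Import all_boot all_order all_algebra.
From mathcomp Require Import all_classical all_reals all_analysis.
From mathcomp Require Import lra.

Set Implicit Arguments.
Unset Strict Implicit.
Unset Printing Implicit Defensive.

Import Order.TTheory GRing.Theory Num.Theory.
Import numFieldNormedType.Exports.

Local Open Scope classical_set_scope.
Local Open Scope ring_scope.

(** * Lipschitz constants and the Lipschitz norm *)

Lemma lipschitz_setTP (R : realType) (X : normedModType R) (f : X -> R) :
  lipschitz f <-> exists k, forall x y, `|f x - f y| <= k * `|x - y|.
Proof.
split=> [|[k fk]].
  move=> [M [_ Mf]]; exists (M + 1) => x y.
  (* [lipschitz] speaks of all sufficiently large constants; [M + 1] lies strictly above the
     threshold. *)
  by have /(_ (x, y)) := Mf (M + 1) (ltr_pwDr ltr01 (lexx M)); apply.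
have : ProperFilter (globally ([set: X] `*` [set: X])).
  by apply: (@globally_properfilter _ _ (0, 0)).
move=> PF; apply: (@klipschitzW _ _ _ k) => -[x y] _; exact: fk.
Qed.

Lemma ler_lip_norm (R : realType) (X : normedModType R) (f : X -> R) (x y : X) :
  Lip0 f -> `|f x - f y| <= lip_norm f * `|x - y|.
Proof.
move=> [/lipschitz_setTP[k fk] _]; have [->|xy] := eqVneq x y.
  by rewrite !subrr !normr0 mulr0.
rewrite -ler_pdivrMr ?normr_gt0 ?subr_eq0//.
apply: ub_le_sup; last by exists (x, y).
exists k => _ [[a b] /= ab <-].
by rewrite ler_pdivrMr ?normr_gt0 ?subr_eq0.
Qed.

Lemma lip_norm_ge0 (R : realType) (X : normedModType R) (f : X -> R) :
  Lip0 f -> 0 <= lip_norm f.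
Proof.
move=> fL; rewrite /lip_norm; set A := (X in sup X).
have [->|/set0P[_ [[x y] /= xy _]]] := eqVneq A set0; first by rewrite sup0.
rewrite -(pmulr_lge0 _ (_ : 0 < `|x - y|)) ?normr_gt0 ?subr_eq0//.
exact: le_trans (normr_ge0 _) (ler_lip_norm x y fL).
Qed.

(** The assumption [0 <= k] handles the trivial space, where [sup] is taken over the empty set and
    equals 0. *)
Lemma lip_norm_le (R : realType) (X : normedModType R) (f : X -> R) (k : R) :
  0 <= k -> (forall x y, `|f x - f y| <= k * `|x - y|) -> lip_norm f <= k.
Proof.
move=> k0 fk; rewrite /lip_norm; set A := (X in sup X).
have [->|A0] := eqVneq A set0; first by rewrite sup0.
apply: ge_sup; first exact/set0P.
move=> _ [[a b] /= ab <-].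
by rewrite ler_pdivrMr ?normr_gt0 ?subr_eq0.
Qed.

(** * Geometrically small steps and dependent choice *)

Lemma cvg_div_expn2 (R : realType) (C : R) : C / 2 ^+ n @[n --> \oo] --> 0.
Proof.
have -> : (fun n => C / 2 ^+ n) = geometric C (2^-1).
  by apply/funext => n; rewrite /= exprVn.
by apply: cvg_geometric; rewrite ger0_norm ?invf_lt1 ?ltr1n.
Qed.

Lemma div_expn2S (R : realType) (C : R) n : C / 2 ^+ n.+1 = C / 2 ^+ n / 2.
Proof. by rewrite exprSr invfM mulrA. Qed.

Lemma cvg_geometric_steps (R : realType) (V : completeNormedModType R)
    (u : nat -> V) (C : R) :
  (forall n, `|u n.+1 - u n| <= C / 2 ^+ n) ->
  exists2 l : V, u n @[n --> \oo] --> l &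
    forall n, `|l - u n| <= 2 * (C / 2 ^+ n).
Proof.
move=> du; have C0 n : 0 <= C / 2 ^+ n by exact: le_trans (du n).
(* The right-hand side is the exact sum of the step bounds from [n] to [n + k - 1]; keeping the
   subtracted tail lets the induction close. *)
have dist_u n k : `|u (n + k)%N - u n| <= 2 * (C / 2 ^+ n) - 2 * (C / 2 ^+ (n + k)).
  elim: k => [|k IH]; first by rewrite addn0 !subrr normr0.
  have := du (n + k)%N; have := ler_distD (u (n + k)%N) (u (n + k).+1) (u n).
  by rewrite addnS div_expn2S; lra.
have near_u n : \forall m \near \oo, `|u m - u n| <= 2 * (C / 2 ^+ n).
  exists n => // m /= nm; rewrite -(subnKC nm).
  by apply: le_trans (dist_u _ _) _; rewrite gerBl mulr_ge0.
have : cvg (u n @[n --> \oo]).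
  apply/cauchy_cvgP/cauchy_exP => e e0.
  have /cvgrPdist_lt/(_ (e / 2)) := cvg_div_expn2 C.
  move=> /(_ (divr_gt0 e0 (ltr0n _ 2)))[N _ /(_ N (leqnn N))].
  rewrite sub0r normrN ger0_norm// => CN; exists (u N).
  apply: filterS (near_u N) => m; rewrite -ball_normE /= distrC.
  by move: CN => /=; lra.
move=> /cvg_ex[l ul]; exists l => // n.
apply: (@cvgr_to_le _ _ _ _ (fun m => `|u m - u n|)) (near_u n).
by apply: cvg_norm; apply: cvgB => //; exact: cvg_cst.
Qed.

Lemma dependent_choice_nat (T : Type) (P : nat -> T -> Prop)
    (Q : nat -> T -> T -> Prop) (s0 : T) :
  P 0%N s0 ->
  (forall n s, P n s -> exists2 s', P n.+1 s' & Q n s s') ->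
  exists2 u : nat -> T, u 0%N = s0 & forall n, P n (u n) /\ Q n (u n) (u n.+1).
Proof.
move=> P0 step.
(* [choice] wants a total relation, so a state violating [P] is simply sent to itself. *)
have /choice[F FP] (p : nat * T) : exists s', P p.1 p.2 -> P p.1.+1 s' /\ Q p.1 p.2 s'.
  case: p => n s /=; have [/step[s' Ps' Qs']|nP] := pselect (P n s).
    by exists s'.
  by exists s.
pose u := fix u n := if n is m.+1 then F (m, u m) else s0.
have Pu n : P n (u n) by elim: n => //= n IH; case: (FP (n, u n) IH).
by exists u => // n; split => //; case: (FP (n, u n) (Pu n)).
Qed.

(** * Distances, segments and directions *)

Lemma dist_lt_ex (R : realType) (X : normedModType R) (v : X) (A : set X) (e : R) :
  A !=set0 -> dist v A < e -> exists2 z, A z & `|v - z| < e.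
Proof.
move=> [a Aa] dve.
have [||_ [z Az <-] vz] := @inf_adherent _ [set `|v - z| | z in A] (e - dist v A).
- by rewrite subr_gt0.
- by split; [exists `|v - a|, a | exists 0 => _ [z _ <-]].
by exists z => //; move: vz; rewrite -/(dist v A) subrKC.
Qed.

Lemma dist_le (R : realType) (X : normedModType R) (v z : X) (A : set X) :
  A z -> dist v A <= `|v - z|.
Proof.
by move=> Az; apply: ge_inf; [exists 0 => _ [? _ <-] | exists z].
Qed.

Lemma conv2_dist_left (R : realType) (X : normedModType R) (x y z : X) :
  conv2 x y z -> `|z - x| <= `|x - y|.
Proof.
move=> [t]; rewrite /= in_itv /= => /andP[t0 t1] <-.
have -> : (1 - t) *: x + t *: y - x = t *: (y - x).
  by rewrite scalerBl scale1r scalerBr addrAC (addrAC x) subrr add0r addrC.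
by rewrite normrZ ger0_norm// distrC ler_piMl.
Qed.

Lemma conv2_left (R : realType) (X : normedModType R) (x y : X) : conv2 x y x.
Proof.
by exists 0; [rewrite /= in_itv /= lexx ler01 | rewrite subr0 scale1r scale0r addr0].
Qed.

Lemma norm_direction (R : realType) (X : normedModType R) (x y : X) :
  x != y -> `|direction x y| = 1.
Proof.
move=> xy; rewrite /direction normrZ normfV normr_id mulVf//.
by rewrite normr_eq0 subr_eq0.
Qed.

(** * Limits of Lipschitz functionals *)

Lemma Lip0B (R : realType) (X : normedModType R) (f g : X -> R) :
  Lip0 f -> Lip0 g -> Lip0 (f \- g).
Proof.
move=> [/lipschitz_setTP[k fk] f0] [/lipschitz_setTP[l gl] g0]; split; last first.
  by rewrite /= f0 g0 subrr.
apply/lipschitz_setTP; exists (k + l) => x y /=.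
rewrite mulrDl (le_trans _ (lerD (fk x y) (gl x y)))//.
have -> : f x - g x - (f y - g y) = (f x - f y) - (g x - g y) by lra.
exact: ler_normB.
Qed.

(** Completeness of [Lip0] with an explicit rate: the limit is taken pointwise, and the Lipschitz
    bounds pass to it. *)
Lemma Lip0_limit (R : realType) (X : normedModType R) (g : nat -> X -> R) (C k : R) :
  (forall n, Lip0 (g n)) -> (forall n, lip_norm (g n) <= k) ->
  (forall n, lip_norm (g n.+1 \- g n) <= C / 2 ^+ n) ->
  exists g' : X -> R,
    [/\ Lip0 g', lip_norm g' <= k &
      forall n x y, `|(g' x - g' y) - (g n x - g n y)| <= 2 * (C / 2 ^+ n) * `|x - y|].
Proof.
move=> gL gk dg.
have k0 : 0 <= k by exact: le_trans (lip_norm_ge0 (gL 0%N)) (gk 0%N).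
have dgx n x y : `|(g n.+1 x - g n.+1 y) - (g n x - g n y)| <= C * `|x - y| / 2 ^+ n.
  rewrite mulrAC (le_trans _ (ler_wpM2r (normr_ge0 _) (dg n)))//.
  have := ler_lip_norm x y (Lip0B (gL n.+1) (gL n)).
  by congr (`|_| <= _); rewrite /=; lra.
have lim_g x : exists l : R, g n x @[n --> \oo] --> l.
  (* All [g n] vanish at 0, so comparing [x] with 0 bounds the increments of the values
     themselves. *)
  have [|l gl _] := @cvg_geometric_steps R R (fun n => g n x) (C * `|x - 0|).
    by move=> n; have := dgx n x 0; rewrite (gL n).2 (gL n.+1).2 !subr0.
  by exists l.
have /choice[g' gg'] := lim_g.
have g'k x y : `|g' x - g' y| <= k * `|x - y|.
  apply: (@cvgr_to_le _ \oo _ _ (fun n => `|g n x - g n y|)).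
    by apply: cvg_norm; exact: cvgB (gg' x) (gg' y).
  near=> n; apply: le_trans (ler_lip_norm x y (gL n)) _.
  by rewrite ler_wpM2r.
exists g'; split.
- split; first by apply/lipschitz_setTP; exists k.
  have := gg' 0; under eq_fun do rewrite (gL _).2.
  by move=> /norm_cvg_unique; apply; exact: cvg_cst.
- exact: lip_norm_le.
move=> n x y.
(* The rate comes from applying the same lemma to the differences [g n x - g n y], whose increments
   scale with the distance from [x] to [y]. *)
have [m|l gl gln] := @cvg_geometric_steps R R (fun n => g n x - g n y) (C * `|x - y|).
  exact: dgx.
have <- : l = g' x - g' y by apply: (norm_cvg_unique gl); exact: cvgB (gg' x) (gg' y).
by rewrite -mulrA [_ / _ * _]mulrAC; exact: gln.
Unshelve. all: by end_near. Qed.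

(** * Iteration of the hypothesis and passage to the limit *)

Theorem lemma4p4 (R : realType) (X : completeNormedModType R)
  (H : forall eps : R, 0 < eps -> exists2 delta : R, 0 < delta &
    forall f : X -> R, Lip0 f -> lip_norm f = 1 ->
    forall x y : X, x != y -> 1 - delta < slope f x y ->
    exists (g : X -> R) (v w : nat -> X),
      [/\ Lip0 g, lip_norm g = 1 & forall n, v n != w n] /\
      [/\ slope g (v n) (w n) @[n --> \oo] --> (1 : R),
          lip_norm (g \- f) < eps &
          forall n,
            [/\ `|direction x y - direction (v n) (w n)| < eps,
                `|v n - w n| < eps &
                dist (v n) (conv2 x y) < eps]]) :
  local_directional_BPBp X.
Proof.
(* The total errors below are at most [2 * c] for the function and the direction and [5 * c] for the
   point, all less than [eps]. *)
move=> eps eps0; pose c := eps / 8; have c0 : 0 < c by rewrite divr_gt0.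
have e0 n : 0 < c / 2 ^+ n by rewrite divr_gt0// exprn_gt0.
pose good d e := forall f : X -> R, Lip0 f -> lip_norm f = 1 ->
  forall x y : X, x != y -> 1 - d < slope f x y ->
  exists (g : X -> R) (v w : nat -> X),
    [/\ Lip0 g, lip_norm g = 1 & forall n, v n != w n] /\
    [/\ slope g (v n) (w n) @[n --> \oo] --> (1 : R), lip_norm (g \- f) < e &
      forall n, [/\ `|direction x y - direction (v n) (w n)| < e,
                    `|v n - w n| < e & dist (v n) (conv2 x y) < e]].
(* Shrinking [d n] below [c / 2 ^+ n] keeps it valid and forces the slopes along the iteration to
   tend to 1. *)
have /choice[d dP] n : exists d : R, [/\ 0 < d, d <= c / 2 ^+ n & good d (c / 2 ^+ n)].
  have [d d0 dP] := H _ (e0 n).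
  exists (Num.min d (c / 2 ^+ n)); split.
  - by rewrite lt_min d0 e0.
  - by rewrite ge_min lexx orbT.
  move=> f fL f1 x y xy fxy; apply: dP => //.
  by apply: le_lt_trans fxy; rewrite lerD2l lerN2 ge_min lexx.
exists (d 0%N); first by case: (dP 0%N).
move=> f0 f0L f01 x0 y0 xy0 fxy0.
(* A state is a function with a pair of points: [P n] makes it a legal input for stage [n], and
   [Q n] records how close the next state is. *)
pose P n (s : (X -> R) * X * X) :=
  [/\ Lip0 s.1.1, lip_norm s.1.1 = 1, s.1.2 != s.2 & 1 - d n < slope s.1.1 s.1.2 s.2].
pose Q n (s t : (X -> R) * X * X) :=
  [/\ lip_norm (t.1.1 \- s.1.1) < c / 2 ^+ n,
      `|direction s.1.2 s.2 - direction t.1.2 t.2| < c / 2 ^+ n,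
      `|t.1.2 - t.2| < c / 2 ^+ n & dist t.1.2 (conv2 s.1.2 s.2) < c / 2 ^+ n].
have [//|n [[f x] y] [/= fL f1 xy fxy]|u u0 uPQ] :=
    @dependent_choice_nat _ P Q (f0, x0, y0).
  have [_ _ dn] := dP n; have [dS0 _ _] := dP n.+1.
  have [g [v [w [[gL g1 vw] [gvw gf vwP]]]]] := dn f fL f1 x y xy fxy.
  (* The slopes tend to 1, so some pair meets the threshold of the next stage; the other estimates
     hold for every index. *)
  have : \forall m \near \oo, 1 - d n.+1 < slope g (v m) (w m).
    by apply: (cvgr_gt 1) => //; rewrite gtrBl.
  move=> [m _ /(_ m (leqnn m)) /= gm].
  by exists (g, v m, w m); [split => /= | case: (vwP m)].
pose g n := (u n).1.1; pose x n := (u n).1.2; pose y n := (u n).2.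
have gL n : Lip0 (g n) by case: (uPQ n) => -[].
have g1 n : lip_norm (g n) = 1 by case: (uPQ n) => -[].
have xy n : x n != y n by case: (uPQ n) => -[].
have gxy n : 1 - c / 2 ^+ n < slope (g n) (x n) (y n).
  have [[_ _ _ gxy] _] := uPQ n; apply: le_lt_trans gxy.
  by rewrite lerD2l lerN2; case: (dP n).
have dg n : lip_norm (g n.+1 \- g n) <= c / 2 ^+ n.
  by apply: ltW; case: (uPQ n) => _ [].
have ddir n : `|direction (x n.+1) (y n.+1) - direction (x n) (y n)| <= c / 2 ^+ n.
  by rewrite distrC; apply: ltW; case: (uPQ n) => _ [].
have dxy n : `|x n.+1 - y n.+1| < c / 2 ^+ n by case: (uPQ n) => _ [].
have xconv n : exists2 z, conv2 (x n) (y n) z & `|x n.+1 - z| < c / 2 ^+ n.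
  apply: dist_lt_ex; first by exists (x n); exact: conv2_left.
  by case: (uPQ n) => _ [].
have [G [GL G1 Gg]] : exists G : X -> R, [/\ Lip0 G, lip_norm G <= 1 &
    forall n a b, `|(G a - G b) - (g n a - g n b)| <= 2 * (c / 2 ^+ n) * `|a - b|].
  by apply: Lip0_limit => // n; rewrite g1.
have [ul udir ulP] := cvg_geometric_steps ddir.
(* The sequence starts at index 1 because the given pair may be far apart. Later, [x n.+2] is within
   [c / 2 ^+ n.+1] of a segment of length below [c / 2 ^+ n] that starts at [x n.+1]. *)
have [v xv vP] : exists2 v, x n.+1 @[n --> \oo] --> v &
    forall n, `|v - x n.+1| <= 2 * (2 * c / 2 ^+ n).
  apply: cvg_geometric_steps => n.
  have [z /conv2_dist_left zx xz] := xconv n.+1.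
  have := ler_distD z (x n.+2) (x n.+1); have := dxy n.
  move: (e0 n) zx xz; rewrite -[2 * c / _]mulrA div_expn2S; lra.
(* The factor 3 is 1 for the defect of [g n] on its own pair plus 2 for replacing [g n] by [G]. *)
have slopeG n : 1 - 3 * (c / 2 ^+ n) <= slope G (x n) (y n) <= lip_norm G.
  have nxy : 0 < `|x n - y n| by rewrite normr_gt0 subr_eq0.
  apply/andP; split; last first.
    by rewrite ler_pdivrMr// (le_trans (ler_norm _))// ler_lip_norm.
  have := gxy n; rewrite /slope ltr_pdivlMr// ler_pdivlMr//.
  by have := Gg n (x n) (y n); rewrite ler_norml => /andP[]; nra.
have cvg_slope_lower : 1 - 3 * (c / 2 ^+ n) @[n --> \oo] --> (1 : R).
  rewrite -[X in _ --> X]subr0 -(mulr0 3).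
  apply: cvgB; first exact: cvg_cst.
  by apply: cvgMr; exact: cvg_div_expn2.
have {}G1 : lip_norm G = 1.
  apply/eqP; rewrite eq_le G1 /=; apply: (cvgr_to_le cvg_slope_lower).
  by near=> n; have /andP[] := slopeG n; exact: le_trans.
have xy_to0 : x n.+1 - y n.+1 @[n --> \oo] --> 0.
  apply/cvgr0Pnorm_lt => r r0.
  have /cvgr0Pnorm_lt/(_ r r0) := cvg_div_expn2 c.
  by apply: filterS => n; rewrite ger0_norm ?(ltW (e0 n))//; exact: lt_trans.
(* The point [z] of the original segment is within [c] of [x 1], which is within [4 * c] of [v]. *)
have [z zconv xz] := xconv 0%N.
have [g0 x0E y0E] : [/\ g 0%N = f0, x 0%N = x0 & y 0%N = y0] by rewrite /g /x /y u0.
exists G, v, ul; split; split => //.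
- have := cvg_norm udir; under eq_fun do rewrite norm_direction//.
  by move=> /(_ _)/norm_cvg_unique; apply; exact: cvg_cst.
- exists x, y; split => //.
  + by rewrite -cvg_shiftS.
  + rewrite -cvg_shiftS -[v]subr0.
    have -> : (fun n => y n.+1) = (fun n => x n.+1 - (x n.+1 - y n.+1)).
      by apply/funext => n; rewrite subKr.
    exact: cvgB.
  + rewrite G1; apply: (squeeze_cvgr _ cvg_slope_lower (cvg_cst (1 : R))).
    by near=> n; rewrite -[X in _ <= _ <= X]G1; exact: slopeG.
- apply: (@le_lt_trans _ _ (2 * c)); last by rewrite /c; lra.
  apply: lip_norm_le => [|a b]; first by rewrite mulr_ge0// ltW.
  have := Gg 0%N a b; rewrite expr0 divr1 g0.
  by congr (`|_| <= _); rewrite /=; lra.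
- by have := ulP 0%N; rewrite expr0 divr1 x0E y0E distrC /c; lra.
- move: zconv; rewrite x0E y0E => /dist_le zv.
  apply: le_lt_trans (zv v) _.
  have := ler_distD (x 1%N) v z; have := vP 0%N; move: xz.
  by rewrite expr0 !divr1 /c; lra.
Unshelve. all: by end_near. Qed.
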